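(* Let $\mathcal{G}_1,\dots,\mathcal{G}_m$ be signed digraphs on $\{1,\dots,n\}$ with signed Laplacians $L_1,\dots,L_m$. If for every $k\in\{1,\dots,m\}$ the matrix $-L_k$ is EEP and normal, then $\mathbb{L}=\{L_1,\dots,L_m\}$ is a consensus set for the switched system $\dot{\mathbf{x}}=-L_{\sigma(t)}\mathbf{x}$.
   Context: For a signed digraph with real weighted adjacency matrix $A$ (entries of any sign), the signed Laplacian is $L=\Sigma-A$, $\Sigma=\mathrm{diag}(\sigma_i)$, $\sigma_i=\sum_jA_{ij}$, so $L\mathbf{1}=0$. $M$ is EEP if there is $t_0\ge0$ with $e^{Mt}$ entrywise positive for all real $t\ge t_0$; $M$ is normal if $MM^\top=M^\top M$. A switching signal is a piecewise constant map $\sigma:[0,\infty)\to\{1,\dots,m\}$ with finitely many discontinuities on every bounded interval. $\mathbb{L}$ is a consensus set if for every switching signal and every $\mathbf{x}(0)\in\mathbb{R}^n$ there is $\alpha\in\mathbb{R}$ with $\lim_{t\to\infty}\mathbf{x}(t)=\alpha\mathbf{1}$. *)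

(* Defs.v *)
From HB Require Import structures.
From mathcomp Require Import all_boot all_order all_algebra.
From mathcomp Require Import all_classical all_reals all_analysis.
Set Implicit Arguments. Unset Strict Implicit. Unset Printing Implicit Defensive.
Import Order.TTheory GRing.Theory Num.Theory.
Import numFieldNormedType.Exports.
Local Open Scope classical_set_scope.
Local Open Scope ring_scope.

Definition signed_laplacian (R : realType) (n : nat) (A : 'M[R]_n) : 'M[R]_n :=
  diag_mx (\row_i (\sum_j A i j)) - A.

Definition expmx (R : realType) (n : nat) (M : 'M[R]_n) : 'M[R]_n :=
  \matrix_(i, j) lim ((fun N : nat => \sum_(k < N) (M ^+ k) i j / (k`!)%:R) @ \oo).

Definition EEP (R : realType) (n : nat) (M : 'M[R]_n) : Prop :=
  exists t0 : R, 0 <= t0 /\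
    forall t : R, t0 <= t -> forall i j, 0 < expmx (t *: M) i j.

Definition normal_mx (R : realType) (n : nat) (M : 'M[R]_n) : Prop :=
  M *m M^T = M^T *m M.

Definition locally_const_at (R : realType) (m : nat) (sigma : R -> 'I_m) (t : R) : Prop :=
  exists2 d : R, 0 < d &
    forall s : R, 0 <= s -> `|s - t| < d -> sigma s = sigma t.

(* Piecewise constant with finitely many discontinuities on every bounded
   interval: on each [0, T] there is a finite set of times outside of which
   sigma is locally constant. *)
Definition switching_signal (R : realType) (m : nat) (sigma : R -> 'I_m) : Prop :=
  forall T : R, exists D : seq R,
    forall t : R, 0 <= t <= T -> t \notin D -> locally_const_at sigma t.

Definition switched_solution (R : realType) (n m : nat) (L : 'I_m -> 'M[R]_n)
    (sigma : R -> 'I_m) (x0 : 'cV[R]_n) (x : R -> 'cV[R]_n) : Prop :=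
  [/\ x 0 = x0,
      {within `[0, +oo[, continuous x} &
      forall t : R, 0 < t -> locally_const_at sigma t ->
        forall i : 'I_n, is_derive t (1 : R) (fun s => x s i 0)
                           ((- L (sigma t) *m x t) i 0)].

Definition consensus_set (R : realType) (n m : nat) (L : 'I_m -> 'M[R]_n) : Prop :=
  forall sigma : R -> 'I_m, switching_signal sigma ->
  forall (x0 : 'cV[R]_n) (x : R -> 'cV[R]_n), switched_solution L sigma x0 x ->
  exists alpha : R, x t @[t --> +oo] --> (const_mx alpha : 'cV[R]_n).

(* Main.v *)
Require Import Defs.
From HB Require Import structures.
From mathcomp Require Import all_boot all_order all_algebra.
From mathcomp Require Import all_classical all_reals all_analysis.
From mathcomp Require Import ring lra.
Set Implicit Arguments. Unset Strict Implicit. Unset Printing Implicit Defensive.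
Import Order.TTheory GRing.Theory Num.Theory.
Import numFieldNormedType.Exports.
Local Open Scope classical_set_scope.
Local Open Scope ring_scope.

(* Write M for one of the matrices - L_k and S = M + M^T. For v with zero sum,
   f(t) = |e^(tM) v|^2 satisfies f' = <w, S w> and, by normality,
   f'' = |S w|^2 for w = e^(tM) v, so by Cauchy-Schwarz f'/f is nondecreasing
   and f(T) >= f(0) exp(T f'(0)/f(0)). On the other hand M 1 = 0 and, again by
   normality, 1^T M = 0, so for large T the positive matrix e^(TM) is doubly
   stochastic and contracts zero-sum vectors: f(T) <= q f(0) with q < 1.
   Hence 2 <v, M v> = f'(0) <= (ln q / T) |v|^2. As there are finitely many
   modes, |x - a 1|^2, with a the conserved mean of x, is a common quadratic
   Lyapunov function that decays exponentially along every switched solution. *)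

(** * Scalar calculus: derivatives, monotonicity with exceptional times, Cauchy-Schwarz *)

Lemma is_derive_sumf (R : realType) (n : nat) (f : 'I_n -> R -> R)
    (df : 'I_n -> R) (t : R) :
  (forall i, is_derive t (1 : R) (f i) (df i)) ->
  is_derive t (1 : R) (fun s => \sum_i f i s) (\sum_i df i).
Proof.
move=> fdf; have -> : (fun s => \sum_i f i s) = \sum_i f i.
  by apply/funext => s; rewrite fct_sumE.
exact: is_derive_sum.
Qed.

Lemma is_derive_prod (R : realType) (f g : R -> R) (df dg t : R) :
  is_derive t (1 : R) f df -> is_derive t (1 : R) g dg ->
  is_derive t (1 : R) (fun s => f s * g s) (df * g t + f t * dg).
Proof.
move=> fdf gdg; apply: (is_derive_eq (is_deriveM fdf gdg)).
by rewrite addrC /GRing.scale /= [g t * _]mulrC.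
Qed.

(** Induction on [D]: an exceptional time inside the interval splits it in two, and continuity of
    [g] there lets the two inequalities chain; any other exceptional time is dropped. Switching
    instants enter the Lyapunov argument only through this lemma. *)
Lemma le_finite_exceptions (R : realType) (g : R -> R) (D : seq R) (a b : R) :
  a <= b -> {within `[a, b], continuous g} ->
  (forall t, a < t < b -> t \notin D ->
     exists2 d, 0 <= d & is_derive t (1 : R) g d) ->
  g a <= g b.
Proof.
elim: D a b => [|e D IH] a b ab cg dg.
  have dg' t : t \in `]a, b[ -> exists2 d, 0 <= d & is_derive t (1 : R) g d.
    by rewrite in_itv /= => tab; exact: dg.
  apply: (@ger0_derive1_ndecr _ _ a b) => // t /dg'[d d0 gd].
    by case: gd.
  by rewrite derive1E derive_val.
have [/andP[ae eb]|eab] := boolP (a < e < b).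
  apply: (@le_trans _ _ (g e)); apply: IH => //; try exact: ltW.
  - apply: continuous_subspaceW cg; apply: subset_itvl.
    by rewrite bnd_simp ltW.
  - move=> t /andP[at_ te] tD; apply: dg; first by rewrite at_ (lt_trans te).
    by rewrite inE negb_or tD (lt_eqF te).
  - apply: continuous_subspaceW cg; apply: subset_itvr.
    by rewrite bnd_simp ltW.
  - move=> t /andP[et tb] tD; apply: dg; first by rewrite tb (lt_trans ae).
    by rewrite inE negb_or tD (gt_eqF et).
apply: IH => // t tab tD; apply: dg => //.
by rewrite inE negb_or tD andbT; apply: contraNneq eab => <-.
Qed.

Lemma eq_finite_exceptions (R : realType) (g : R -> R) (D : seq R) (a b : R) :
  a <= b -> {within `[a, b], continuous g} ->
  (forall t, a < t < b -> t \notin D -> is_derive t (1 : R) g 0) ->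
  g a = g b.
Proof.
move=> ab cg dg; apply/eqP; rewrite eq_le; apply/andP; split.
  apply: (@le_finite_exceptions _ g D a b ab cg) => t tab tD.
  by exists 0 => //; exact: dg.
rewrite -lerN2.
apply: (@le_finite_exceptions _ (fun s => - g s) D a b ab) => [t|t tab tD].
  by apply: cvgN; exact: cg.
by exists 0 => //; apply: (is_derive_eq (is_deriveN (dg t tab tD))); rewrite oppr0.
Qed.

(** With the integrating factor, [f s * expR (- c * s)] has derivative
    [(d - c * f s) * expR (- c * s)], which is nonnegative off [D]. *)
Lemma gronwall_ge (R : realType) (f : R -> R) (D : seq R) (c T : R) :
  0 <= T -> {within `[0, T], continuous f} ->
  (forall t, 0 < t < T -> t \notin D ->
     exists2 d, c * f t <= d & is_derive t (1 : R) f d) ->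
  f 0 * expR (c * T) <= f T.
Proof.
move=> T0 cf df; rewrite -ler_pdivlMr ?expR_gt0// -expRN -mulNr.
pose e (s : R) := expR (- c * s).
have de t : is_derive t (1 : R) e (- c * e t).
  have dl : is_derive t (1 : R) (fun s => - c * s) (- c).
    apply: (is_derive_eq (is_derive_prod
      (is_derive_cst (- c) t 1) (is_derive_id t 1))).
    by rewrite mul0r add0r mulr1.
  by rewrite mulrC; exact: (is_derive1_comp (is_derive_expR (- c * t)) dl).
suff : f 0 * e 0 <= f T * e T by rewrite /e mulr0 expR0 mulr1.
apply: (@le_finite_exceptions _ (fun s => f s * e s) D 0 T) => //.
  have ce : {within `[0, T], continuous e}.
    apply: continuous_subspaceT => t; apply: differentiable_continuous.
    by apply/derivable1_diffP; case: (de t).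
  by move=> t; apply: cvgM; [exact: cf | exact: ce].
move=> t t0T tD; have [d fd dfd] := df t t0T tD.
exists (d * e t + f t * (- c * e t)); last exact: is_derive_prod.
have -> : d * e t + f t * (- c * e t) = (d - c * f t) * e t by ring.
by rewrite mulr_ge0 ?subr_ge0// expR_ge0.
Qed.

(** Lagrange's identity: twice the gap equals the double sum of
    [a i * a j * (x i * y j - x j * y i) ^+ 2]. The weights will be the rows of a nonnegative
    matrix. *)
Lemma weighted_CauchySchwarz (R : realType) (n : nat) (a x y : 'I_n -> R) :
  (forall i, 0 <= a i) ->
  (\sum_i a i * x i * y i) ^+ 2 <=
  (\sum_i a i * x i ^+ 2) * (\sum_i a i * y i ^+ 2).
Proof.
move=> a0; rewrite -subr_ge0 -(pmulr_rge0 _ (ltr0Sn _ 1)).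
have -> : 2 * ((\sum_i a i * x i ^+ 2) * (\sum_i a i * y i ^+ 2) -
     (\sum_i a i * x i * y i) ^+ 2) =
   \sum_i \sum_j a i * a j * (x i * y j - x j * y i) ^+ 2.
  transitivity ((\sum_i a i * x i ^+ 2) * (\sum_j a j * y j ^+ 2) +
    (\sum_i a i * y i ^+ 2) * (\sum_j a j * x j ^+ 2) -
    2 * ((\sum_i a i * x i * y i) * (\sum_j a j * x j * y j))); first by ring.
  rewrite !mulr_suml mulr_sumr -big_split -sumrB /=; apply: eq_bigr => i _.
  rewrite !mulr_sumr -big_split -sumrB /=; apply: eq_bigr => j _.
  by ring.
by do 2 (apply: sumr_ge0 => ? _); apply: mulr_ge0; [exact: mulr_ge0 | exact: sqr_ge0].
Qed.

(** * The matrix exponential, entry by entry *)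

Definition expmx_coef (R : realType) (n : nat) (M : 'M[R]_n) (i j : 'I_n)
  (k : nat) : R := (M ^+ k) i j / k`!%:R.

(** Reading each entry of the exponential as a scalar power series in [t] makes termwise
    differentiation available. *)
Lemma expmx_pseries (R : realType) (n : nat) (M : 'M[R]_n) (t : R) i j :
  expmx (t *: M) i j = limn (pseries (expmx_coef M i j) t).
Proof.
rewrite mxE; congr (lim (_ @ \oo)); apply/funext => N.
rewrite /pseries /series /= big_mkord; apply: eq_bigr => k _.
suff -> : (t *: M) ^+ k = t ^+ k *: M ^+ k by rewrite mxE /expmx_coef; ring.
elim: (k : nat) => [|k' IH]; first by rewrite !expr0 scale1r.
by rewrite !exprS IH -!mulmxE -scalemxAl -scalemxAr scalerA.
Qed.

Lemma mxpow_entry_le (R : realType) (n : nat) (M : 'M[R]_n) k i j :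
  `|(M ^+ k) i j| <= (1 + \sum_a \sum_b `|M a b|) ^+ k.
Proof.
set B := 1 + _.
have S0 : 0 <= \sum_a \sum_b `|M a b| by do 2 apply: sumr_ge0 => ? _.
elim: k i j => [|k IH] i j.
  by rewrite !expr0 mxE; case: eqP; rewrite ?normr1 ?normr0 ?ler01.
rewrite !exprS -mulmxE mxE; apply: le_trans (ler_norm_sum _ _ _) _.
apply: (@le_trans _ _ (\sum_b `|M i b| * B ^+ k)).
  by apply: ler_sum => b _; rewrite normrM ler_wpM2l.
rewrite -mulr_suml ler_wpM2r ?exprn_ge0 ?addr_ge0//.
rewrite /B [X in 1 + X](bigD1 i)//= addrCA lerDl addr_ge0//.
by do 2 apply: sumr_ge0 => ? _.
Qed.

(** Entries of [M ^+ k] grow at most like [B ^+ k], so the series is dominated by the exponential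
    series at [B * |t|]. *)
Lemma is_cvg_expmx_coef (R : realType) (n : nat) (M : 'M[R]_n) i j (t : R) :
  cvgn (pseries (expmx_coef M i j) t).
Proof.
set B := 1 + \sum_a \sum_b `|M a b|.
have B0 : 0 <= B by rewrite addr_ge0//; do 2 apply: sumr_ge0 => ? _.
apply: normed_cvg.
apply: (series_le_cvg _ _ _ (is_cvg_series_exp_coeff (B * `|t|))) => k /=.
- exact: normr_ge0.
- by rewrite exp_coeff_ge0// mulr_ge0.
rewrite /expmx_coef /exp_coeff /= !normrM normfV normr_nat normrX exprMn mulrAC.
by rewrite ler_wpM2r// ler_wpM2r// mxpow_entry_le.
Qed.

Lemma pseries_diffs_expmx_coef (R : realType) (n : nat) (M : 'M[R]_n) i j :
  pseries_diffs (expmx_coef M i j) = fun k => (M ^+ k.+1) i j / k`!%:R.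
Proof.
apply/funext => k; rewrite /pseries_diffs /expmx_coef factS natrM invfM.
by rewrite mulrCA mulVKf.
Qed.

(** Entries of the product are finite linear combinations of convergent entry series. Taking [P] to
    be [M] and [M *m M] covers the first two formal derivatives of the exponential. *)
Lemma cvg_mulmx_expmx (R : realType) (n : nat) (P M : 'M[R]_n) (t : R) i j :
  pseries (fun k => (P *m M ^+ k) i j / k`!%:R) t @ \oo -->
  (P *m expmx (t *: M)) i j.
Proof.
rewrite mxE.
have -> : pseries (fun k => (P *m M ^+ k) i j / k`!%:R) t =
    fun N => \sum_l P i l * pseries (expmx_coef M l j) t N.
  apply/funext => N; under [RHS]eq_bigr do rewrite mulr_sumr.
  rewrite exchange_big; apply: eq_bigr => k _ /=.
  rewrite mxE !mulr_suml; apply: eq_bigr => l _.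
  by rewrite /expmx_coef; ring.
apply: cvg_big => [|l _]; first exact: add_continuous.
apply: cvgM; [exact: cvg_cst | rewrite expmx_pseries].
exact: is_cvg_expmx_coef.
Qed.

Lemma cvg_expmx_mulmx (R : realType) (n : nat) (P M : 'M[R]_n) (t : R) i j :
  pseries (fun k => (M ^+ k *m P) i j / k`!%:R) t @ \oo -->
  (expmx (t *: M) *m P) i j.
Proof.
rewrite mxE.
have -> : pseries (fun k => (M ^+ k *m P) i j / k`!%:R) t =
    fun N => \sum_l pseries (expmx_coef M i l) t N * P l j.
  apply/funext => N; under [RHS]eq_bigr do rewrite mulr_suml.
  rewrite exchange_big; apply: eq_bigr => k _ /=.
  rewrite mxE !mulr_suml; apply: eq_bigr => l _.
  by rewrite /expmx_coef; ring.
apply: cvg_big => [|l _]; first exact: add_continuous.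
apply: cvgM; [rewrite expmx_pseries | exact: cvg_cst].
exact: is_cvg_expmx_coef.
Qed.

Lemma is_derive_expmx (R : realType) (n : nat) (M : 'M[R]_n) (t : R) i j :
  is_derive t (1 : R) (fun s => expmx (s *: M) i j)
    ((M *m expmx (t *: M)) i j).
Proof.
have -> : (fun s => expmx (s *: M) i j) =
    fun s => limn (pseries (expmx_coef M i j) s).
  by apply/funext => s; rewrite expmx_pseries.
have dE : pseries_diffs (expmx_coef M i j) =
    fun k => (M *m M ^+ k) i j / k`!%:R.
  rewrite pseries_diffs_expmx_coef; apply/funext => k.
  by rewrite exprS mulmxE.
have ddE : pseries_diffs (pseries_diffs (expmx_coef M i j)) =
    fun k => ((M *m M) *m M ^+ k) i j / k`!%:R.
  rewrite pseries_diffs_expmx_coef; apply/funext => k.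
  rewrite /pseries_diffs factS natrM invfM mulrCA mulVKf//.
  by rewrite !exprS !mulmxE mulrA.
have <- : limn (pseries (pseries_diffs (expmx_coef M i j)) t) =
    (M *m expmx (t *: M)) i j.
  by rewrite dE; apply/cvg_lim => //; exact: cvg_mulmx_expmx.
(* Termwise differentiation at [t] asks that the series and its first two formal derivatives
   converge at some point of larger modulus; [|t| + 1] serves. *)
apply: (@pseries_snd_diffs _ _ (`|t| + 1)).
- exact: is_cvg_expmx_coef.
- by rewrite dE; apply/cvg_ex; eexists; exact: cvg_mulmx_expmx.
- by rewrite ddE; apply/cvg_ex; eexists; exact: cvg_mulmx_expmx.
- by rewrite [ltRHS]ger0_norm// ltrDl.
Qed.

(** Both products are sums of the same series, with terms built on [M ^+ k.+1]. *)
Lemma expmx_comm (R : realType) (n : nat) (M : 'M[R]_n) (t : R) :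
  expmx (t *: M) *m M = M *m expmx (t *: M).
Proof.
apply/matrixP => i j.
rewrite -(cvg_lim _ (@cvg_expmx_mulmx R n M M t i j))//.
rewrite -(cvg_lim _ (@cvg_mulmx_expmx R n M M t i j))//.
congr (limn (pseries _ _)); apply/funext => k.
by rewrite !mulmxE -exprSr exprS.
Qed.

Lemma expmx0 (R : realType) (n : nat) (M : 'M[R]_n) : expmx (0 *: M) = 1%:M.
Proof.
apply/matrixP => i j; rewrite expmx_pseries; apply/cvg_lim => //.
apply: (@cvg_near_cst _ _ _ _ _); exists 1%N => // -[//|N] _.
rewrite /pseries /series /= big_nat_recl//= big1 ?addr0 => [|k _].
  by rewrite expr0 mulr1 /expmx_coef expr0 fact0 divr1.
by rewrite expr0n mulr0.
Qed.

(** The derivative of [expmx (s *: M)] applied to the all-ones vector is [expmx (s *: M) *m M]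
    applied to it, hence zero; the value at [s = 0] persists. *)
Lemma expmx_rows (R : realType) (n : nat) (M : 'M[R]_n) (t : R) :
  M *m (const_mx 1 : 'cV[R]_n) = 0 ->
  expmx (t *: M) *m (const_mx 1 : 'cV[R]_n) = const_mx 1.
Proof.
move=> M1; apply/colP => i.
pose g s := (expmx (s *: M) *m (const_mx 1 : 'cV[R]_n)) i 0.
have dg s : is_derive s (1 : R) g 0.
  have -> : g = fun s => \sum_j expmx (s *: M) i j.
    apply/funext => r; rewrite /g mxE; apply: eq_bigr => j _.
    by rewrite [X in _ * X]mxE mulr1.
  apply: (is_derive_eq (is_derive_sumf (fun j => is_derive_expmx M s i j))).
  transitivity ((expmx (s *: M) *m (M *m (const_mx 1 : 'cV[R]_n))) i 0).
    rewrite mulmxA expmx_comm mxE; apply: eq_bigr => j _.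
    by rewrite [X in _ * X]mxE mulr1.
  by rewrite M1 mulmx0 mxE.
rewrite -[LHS]/(g t) (@is_derive_0_is_cst _ g t 0 dg) /g expmx0.
by rewrite mul1mx.
Qed.

Lemma expmx_cols (R : realType) (n : nat) (M : 'M[R]_n) (t : R) :
  (const_mx 1 : 'rV[R]_n) *m M = 0 ->
  (const_mx 1 : 'rV[R]_n) *m expmx (t *: M) = const_mx 1.
Proof.
move=> M1; apply/rowP => i.
pose g s := ((const_mx 1 : 'rV[R]_n) *m expmx (s *: M)) 0 i.
have dg s : is_derive s (1 : R) g 0.
  have -> : g = fun s => \sum_j expmx (s *: M) j i.
    apply/funext => r; rewrite /g mxE; apply: eq_bigr => j _.
    by rewrite [X in X * _]mxE mul1r.
  apply: (is_derive_eq (is_derive_sumf (fun j => is_derive_expmx M s j i))).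
  transitivity (((const_mx 1 : 'rV[R]_n) *m M *m expmx (s *: M)) 0 i).
    rewrite -mulmxA mxE; apply: eq_bigr => j _.
    by rewrite [X in _ = X * _]mxE mul1r.
  by rewrite M1 mul0mx mxE.
rewrite -[LHS]/(g t) (@is_derive_0_is_cst _ g t 0 dg) /g expmx0.
by rewrite mulmx1.
Qed.

(** * The Euclidean inner product and the norm along normal flows *)

Definition dotv (R : realType) (n : nat) (u v : 'cV[R]_n) : R :=
  (u^T *m v) 0 0.

Lemma dotvE (R : realType) (n : nat) (u v : 'cV[R]_n) :
  dotv u v = \sum_i u i 0 * v i 0.
Proof. by rewrite /dotv mxE; apply: eq_bigr => i _; rewrite mxE. Qed.

Lemma dotvC (R : realType) (n : nat) (u v : 'cV[R]_n) : dotv u v = dotv v u.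
Proof. by rewrite !dotvE; apply: eq_bigr => i _; rewrite mulrC. Qed.

Lemma dotv_mulmx (R : realType) (n : nat) (M : 'M[R]_n) (u v : 'cV[R]_n) :
  dotv u (M *m v) = dotv (M^T *m u) v.
Proof. by rewrite /dotv trmx_mul trmxK mulmxA. Qed.

Lemma dotvDr (R : realType) (n : nat) (u v w : 'cV[R]_n) :
  dotv u (v + w) = dotv u v + dotv u w.
Proof. by rewrite /dotv mulmxDr mxE. Qed.

Lemma dotvv_ge0 (R : realType) (n : nat) (v : 'cV[R]_n) : 0 <= dotv v v.
Proof. by rewrite dotvE; apply: sumr_ge0 => i _; rewrite -expr2 sqr_ge0. Qed.

Lemma sqr_le_dotvv (R : realType) (n : nat) (v : 'cV[R]_n) i :
  v i 0 ^+ 2 <= dotv v v.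
Proof.
rewrite dotvE (bigD1 i)//= -expr2 lerDl.
by apply: sumr_ge0 => j _; rewrite -expr2 sqr_ge0.
Qed.

Lemma dotvv_eq0 (R : realType) (n : nat) (v : 'cV[R]_n) : dotv v v = 0 -> v = 0.
Proof.
move=> v0; apply/colP => i; rewrite mxE; apply/eqP.
by rewrite -sqrf_eq0 eq_le sqr_ge0 -v0 sqr_le_dotvv.
Qed.

Lemma dotv_CauchySchwarz (R : realType) (n : nat) (u v : 'cV[R]_n) :
  dotv u v ^+ 2 <= dotv u u * dotv v v.
Proof.
have := @weighted_CauchySchwarz R n (fun=> 1) (u^~ 0) (v^~ 0) (fun=> ler01).
rewrite !dotvE; congr (_ ^+ 2 <= _ * _); apply: eq_bigr => i _;
  by rewrite ?mul1r// expr2.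
Qed.

(** Each product of two coordinates is at most [dotv v v] in absolute value. This crude bound serves
    to keep the norm of a trajectory away from zero. *)
Lemma dotv_mulmx_ge (R : realType) (n : nat) (M : 'M[R]_n) (v : 'cV[R]_n) :
  - (\sum_i \sum_j `|M i j|) * dotv v v <= dotv v (M *m v).
Proof.
rewrite [dotv v (M *m v)]dotvE mulNr lerNl mulr_suml -sumrN; apply: ler_sum => i _.
rewrite mxE mulr_sumr -sumrN mulr_suml; apply: ler_sum => j _.
have vv : `|v i 0 * v j 0| <= dotv v v.
  have := sqr_le_dotvv v i; have := sqr_le_dotvv v j.
  have := sqr_ge0 (`|v i 0| - `|v j 0|).
  rewrite sqrrB !real_normK ?num_real// normrM -mulr_natl; lra.
apply: le_trans (ler_norm _) _; rewrite normrN mulrCA normrM.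
exact: ler_wpM2l.
Qed.

Lemma is_derive_mulmx (R : realType) (n : nat) (P : 'M[R]_n)
    (w : R -> 'cV[R]_n) (dw : 'cV[R]_n) (t : R) :
  (forall i, is_derive t (1 : R) (fun s => w s i 0) (dw i 0)) ->
  forall i, is_derive t (1 : R) (fun s => (P *m w s) i 0) ((P *m dw) i 0).
Proof.
move=> wdw i.
have -> : (fun s => (P *m w s) i 0) = fun s => \sum_j P i j * w s j 0.
  by apply/funext => s; rewrite mxE.
by rewrite mxE; exact: is_derive_sumf.
Qed.

Lemma is_derive_dotv (R : realType) (n : nat) (u w : R -> 'cV[R]_n)
    (du dw : 'cV[R]_n) (t : R) :
  (forall i, is_derive t (1 : R) (fun s => u s i 0) (du i 0)) ->
  (forall i, is_derive t (1 : R) (fun s => w s i 0) (dw i 0)) ->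
  is_derive t (1 : R) (fun s => dotv (u s) (w s)) (dotv du (w t) + dotv (u t) dw).
Proof.
move=> udu wdw.
have -> : (fun s => dotv (u s) (w s)) = fun s => \sum_i u s i 0 * w s i 0.
  by apply/funext => s; rewrite dotvE.
rewrite !dotvE -big_split /=; apply: is_derive_sumf => i.
exact: is_derive_prod (udu i) (wdw i).
Qed.

Lemma continuous_is_derive (R : realType) (A : set R) (f df : R -> R) :
  (forall t, is_derive t (1 : R) f (df t)) -> {within A, continuous f}.
Proof.
move=> fdf; apply: continuous_subspaceT => t.
by apply/differentiable_continuous/derivable1_diffP; case: (fdf t).
Qed.

(* The squared norm of a trajectory of a normal system is log-convex in time,
   so it lies above its tangent exponential at time 0. *)
Lemma normal_expmx_ge (R : realType) (n : nat) (M : 'M[R]_n) (v : 'cV[R]_n)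
    (T : R) : normal_mx M -> v != 0 -> 0 <= T ->
  dotv v v * expR (dotv v ((M + M^T) *m v) / dotv v v * T) <=
  dotv (expmx (T *: M) *m v) (expmx (T *: M) *m v).
Proof.
move=> nM v0 T0; set S := M + M^T.
pose w s := expmx (s *: M) *m v.
pose f s := dotv (w s) (w s); pose g s := dotv (w s) (S *m w s).
have w0 : w 0 = v by rewrite /w expmx0 mul1mx.
(* Normality enters here: moving [S] past [M] turns the derivative of [g] into the square
   [dotv (S *m w t) (S *m w t)]. *)
have SM : S *m M = M *m S by rewrite /S mulmxDr mulmxDl nM.
have dw (t : R) i : is_derive t (1 : R) (fun s => w s i 0) ((M *m w t) i 0).
  have -> : (fun s => w s i 0) = fun s => \sum_j v j 0 * expmx (s *: M) i j.
    apply/funext => s; rewrite /w mxE; apply: eq_bigr => j _; exact: mulrC.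
  rewrite /w mulmxA mxE; apply: is_derive_sumf => j.
  apply: (is_derive_eq (is_derive_prod (is_derive_cst (v j 0) t 1)
    (is_derive_expmx M t i j))).
  by rewrite mul0r add0r mulrC.
have df (t : R) : is_derive t (1 : R) f (g t).
  apply: (is_derive_eq (is_derive_dotv (dw t) (dw t))).
  by rewrite /g /S mulmxDl dotvDr [dotv _ (M^T *m _)]dotv_mulmx trmxK addrC.
have dg (t : R) : is_derive t (1 : R) g (dotv (S *m w t) (S *m w t)).
  apply: (is_derive_eq (is_derive_dotv (dw t) (is_derive_mulmx S (dw t)))).
  rewrite [X in _ = dotv _ X]mulmxDl dotvDr; congr (_ + _); first exact: dotvC.
  by rewrite mulmxA SM -mulmxA dotv_mulmx dotvC.
have f0 : 0 < f 0.
  rewrite /f w0 lt_neqAle dotvv_ge0 andbT eq_sym.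
  by apply: contraNneq v0 => /dotvv_eq0 ->.
(* Division by [f] needs a trajectory that never reaches zero: the crude lower bound on the
   quadratic form of [S] gives at worst exponential decay. *)
have fgt0 (t : R) : 0 <= t -> 0 < f t.
  move=> t0; pose c := - (\sum_i \sum_j `|S i j|).
  apply: lt_le_trans (_ : f 0 * expR (c * t) <= _).
    by rewrite mulr_gt0 ?expR_gt0.
  apply: (@gronwall_ge _ f [::]) => // [|s _ _].
    exact: continuous_is_derive df.
  by exists (g s) => //; exact: dotv_mulmx_ge.
have dh (t : R) : 0 < t -> is_derive t (1 : R) (fun s => g s * (f s)^-1)
    ((dotv (S *m w t) (S *m w t) * f t - g t ^+ 2) / f t ^+ 2).
  move=> t0; have ft : f t != 0 by rewrite gt_eqF ?fgt0// ltW.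
  apply: (is_derive_eq (is_derive_prod (dg t) (is_deriveV ft (df t)))).
  by rewrite /GRing.scale /=; field.
have h_ge (t : R) : 0 < t -> g 0 / f 0 <= g t / f t.
  move=> t0; apply: (@le_finite_exceptions _ (fun s => g s / f s) [::]).
  - exact: ltW.
  - apply: continuous_in_subspaceT => s; rewrite inE /= in_itv /= => /andP[s0 _].
    apply: cvgM.
      by apply/differentiable_continuous/derivable1_diffP; case: (dg s).
    apply: cvgV; first by rewrite gt_eqF ?fgt0.
    by apply/differentiable_continuous/derivable1_diffP; case: (df s).
  (* The numerator of the derivative of [g / f] is the Cauchy-Schwarz gap for [w s] and
     [S *m w s]. *)
  move=> s /andP[s0 _] _; eexists; last exact: dh.
  rewrite divr_ge0 ?sqr_ge0// subr_ge0 mulrC; exact: dotv_CauchySchwarz.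
suff : f 0 * expR (g 0 / f 0 * T) <= f T by rewrite /f /g w0.
apply: (@gronwall_ge _ f [::]) => // [|t /andP[t0 _] _].
  exact: continuous_is_derive df.
by exists (g t) => //; rewrite -ler_pdivlMr ?h_ge// fgt0// ltW.
Qed.

(** * Strict dissipation on zero-sum vectors *)

(** Subtracting a constant [d] below all entries does not change [P *m v] for zero-sum [v], and
    leaves a nonnegative matrix whose row and column sums are [1 - d] times the dimension,
    subtracted as [1 - n.+1%:R * d]. Cauchy-Schwarz along rows, then summation along columns, gives
    the square of that number as contraction factor. *)
Lemma doubly_stochastic_contraction (R : realType) (n : nat) (P : 'M[R]_n) :
  (forall i j, 0 < P i j) ->
  P *m (const_mx 1 : 'cV[R]_n) = const_mx 1 ->
  (const_mx 1 : 'rV[R]_n) *m P = const_mx 1 ->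
  exists2 q : R, 0 < q < 1 & forall v : 'cV[R]_n, \sum_i v i 0 = 0 ->
    dotv (P *m v) (P *m v) <= q * dotv v v.
Proof.
case: n P => [|n] P P0 P1 P1'.
  exists (2^-1); first by lra.
  by move=> v _; rewrite !dotvE !big_ord0 mulr0.
(* The cap 1/2 keeps [d] below 1, so that [q = 1 - d] is positive even for the 1 by 1 matrix with
   entry 1. *)
pose d := \big[Num.min/(2^-1 : R)]_(ij : 'I_n.+1 * 'I_n.+1) P ij.1 ij.2.
have d0 : 0 < d by apply: lt_bigmin => //; lra.
have d1 : d < 1.
  by apply: le_lt_trans (bigmin_le_id _ _ _ _) _; lra.
have dP i j : d <= P i j by apply: (bigmin_le _ (i, j)).
have rows i : \sum_j (P i j - d) = 1 - n.+1%:R * d.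
  rewrite sumrB sumr_const card_ord mulr_natl; congr (_ - _).
  have := congr1 (fun M : 'cV[R]_n.+1 => M i 0) P1; rewrite !mxE => <-.
  by apply: eq_bigr => j _; rewrite mxE mulr1.
have cols j : \sum_i (P i j - d) = 1 - n.+1%:R * d.
  rewrite sumrB sumr_const card_ord mulr_natl; congr (_ - _).
  have := congr1 (fun M : 'rV[R]_n.+1 => M 0 j) P1'; rewrite !mxE => <-.
  by apply: eq_bigr => i _; rewrite mxE mul1r.
have r0 : 0 <= 1 - n.+1%:R * d.
  by rewrite -(rows ord0); apply: sumr_ge0 => j _; rewrite subr_ge0.
have r1 : 1 - n.+1%:R * d <= 1 - d.
  by rewrite lerD2l lerN2 ler_peMl ?ler1n// ltW.
exists (1 - d); first by lra.
move=> v v0; apply: (@le_trans _ _ ((1 - n.+1%:R * d) ^+ 2 * dotv v v)); last first.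
  rewrite ler_wpM2r ?dotvv_ge0//; nra.
have Pv i : (P *m v) i 0 = \sum_j (P i j - d) * 1 * v j 0.
  rewrite mxE; under [RHS]eq_bigr do rewrite mulr1 mulrBl.
  by rewrite sumrB -mulr_sumr v0 mulr0 subr0.
apply: (@le_trans _ _ (\sum_i (1 - n.+1%:R * d) * \sum_j (P i j - d) * v j 0 ^+ 2)).
  rewrite dotvE; apply: ler_sum => i _; rewrite -expr2 Pv.
  have Pd j : 0 <= P i j - d by rewrite subr_ge0.
  apply: le_trans (weighted_CauchySchwarz _ _ Pd) _.
  by under eq_bigr do rewrite expr1n mulr1; rewrite rows.
rewrite -mulr_sumr exchange_big /= expr2 -mulrA ler_wpM2l//.
rewrite dotvE mulr_sumr le_eqVlt; apply/orP; left; apply/eqP.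
by apply: eq_bigr => j _; rewrite -mulr_suml cols expr2.
Qed.

(** By normality the squared norm of [M^T *m v] is [dotv v (M^T *m (M *m v))]. For a Laplacian, zero
    row sums thus force zero column sums. *)
Lemma normal_mx_ker_tr (R : realType) (n : nat) (M : 'M[R]_n) (v : 'cV[R]_n) :
  normal_mx M -> M *m v = 0 -> M^T *m v = 0.
Proof.
move=> nM Mv; apply: dotvv_eq0.
by rewrite -dotv_mulmx mulmxA nM -mulmxA Mv mulmx0 /dotv mulmx0 mxE.
Qed.

Lemma EEP_normal_dissipative (R : realType) (n : nat) (M : 'M[R]_n) :
  EEP M -> normal_mx M -> M *m (const_mx 1 : 'cV[R]_n) = 0 ->
  exists2 c : R, 0 < c & forall v : 'cV[R]_n, \sum_i v i 0 = 0 ->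
    2 * dotv v (M *m v) <= - c * dotv v v.
Proof.
move=> [t0 [t0_ge0 Mpos]] nM M1.
have M1' : (const_mx 1 : 'rV[R]_n) *m M = 0.
  apply: trmx_inj; rewrite trmx_mul trmx_const trmx0.
  exact: normal_mx_ker_tr.
(* Adding 1 makes [T] strictly positive even when [t0] is 0. *)
pose T := t0 + 1; have t0T : t0 <= T by rewrite lerDl.
have [q /andP[q0 q1] qP] := doubly_stochastic_contraction
  (Mpos T t0T) (expmx_rows T M1) (expmx_cols T M1').
have T0 : 0 < T by rewrite ltr_wpDl.
exists (- ln q / T); first by rewrite divr_gt0// oppr_gt0 ln_lt0// q0.
move=> v v_sum; have [->|v0] := eqVneq v 0.
  by rewrite /dotv !mulmx0 mxE !mulr0.
have vv0 : 0 < dotv v v.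
  rewrite lt_neqAle dotvv_ge0 andbT eq_sym.
  by apply: contraNneq v0 => /dotvv_eq0 ->.
(* The tangent exponential and the contraction squeeze the norm at time [T]; cancelling [dotv v v]
   and taking logarithms bounds the initial logarithmic slope by [ln q / T]. *)
have := le_trans (normal_expmx_ge nM v0 (ltW T0)) (qP v v_sum).
rewrite [q * _]mulrC ler_pM2l// -{1}(lnK (x := q)) ?posrE// ler_expR.
rewrite -ler_pdivlMr// ler_pdivrMr// => /le_trans.
rewrite mulmxDl dotvDr [dotv v (M^T *m v)]dotv_mulmx trmxK [dotv (M *m v) v]dotvC.
by rewrite -mulr2n mulr_natl [- ln q / T]mulNr opprK; apply.
Qed.

(** * Convergence of the switched system *)

Lemma continuous_coord_sum (R : realType) (n : nat) (A : set R)
    (x : R -> 'cV[R]_n) (h : 'I_n -> R -> R) :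
  (forall i, continuous (h i)) ->
  {within A, continuous x} ->
  {within A, continuous (fun s => \sum_i h i (x s i 0))}.
Proof.
move=> ch cx t; apply: cvg_big => [|i _]; first exact: add_continuous.
apply: (@cvg_comp _ _ _ (fun s => x s i 0) (h i) _ (nbhs (x t i 0))).
  exact: cvg_comp (cx t) (@coord_continuous _ _ _ i 0 (x t)).
exact: ch.
Qed.

(** The least of finitely many positive rates works for all modes; the default 1 keeps the minimum
    positive over an empty index set. *)
Lemma uniform_lower_rate (R : realType) (m : nat) (Q : 'I_m -> R -> Prop) :
  (forall k c c', c' <= c -> Q k c -> Q k c') ->
  (forall k, exists2 c, 0 < c & Q k c) ->
  exists2 c, 0 < c & forall k, Q k c.
Proof.
move=> Qle /(_ _)/cid2-/all_sig[f fP].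
exists (\big[Num.min/1]_k f k).
  by apply: lt_bigmin => // k _; case: (fP k).
by move=> k; apply: (Qle k (f k)); [exact: bigmin_le | case: (fP k)].
Qed.

Lemma signed_laplacian_const (R : realType) (n : nat) (A : 'M[R]_n) (a : R) :
  - signed_laplacian A *m (const_mx a : 'cV[R]_n) = 0.
Proof.
have Aa : A *m (const_mx a : 'cV[R]_n) = \col_i ((\sum_j A i j) * a).
  by apply/colP => i; rewrite !mxE mulr_suml; apply: eq_bigr => j _; rewrite mxE.
apply/colP => i.
by rewrite mulNmx mulmxBl mul_diag_mx Aa !mxE subrr oppr0.
Qed.

Theorem theorem7 (R : realType) (n m : nat) (A : 'I_m -> 'M[R]_n) :
  (forall k : 'I_m, EEP (- signed_laplacian (A k)) /\
                    normal_mx (- signed_laplacian (A k))) ->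
  consensus_set (fun k => signed_laplacian (A k)).
Proof.
move=> AP sigma sw x0 x [xx0 cx dx].
pose M k := - signed_laplacian (A k).
have M1 k : M k *m (const_mx 1 : 'cV[R]_n) = 0 by exact: signed_laplacian_const.
have M1' k : (const_mx 1 : 'rV[R]_n) *m M k = 0.
  apply: trmx_inj; rewrite trmx_mul trmx_const trmx0.
  by apply: normal_mx_ker_tr => //; case: (AP k).
have [c c0 cP] : exists2 c : R, 0 < c & forall k, forall v : 'cV[R]_n,
    \sum_i v i 0 = 0 -> 2 * dotv v (M k *m v) <= - c * dotv v v.
  apply: uniform_lower_rate => [k c c' c'c cP v v0|k].
    by apply: le_trans (cP v v0) _; rewrite ler_wpM2r ?dotvv_ge0// lerN2.
  by case: (AP k) => ? ?; exact: EEP_normal_dissipative.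
have cxT T : {within `[0, T], continuous x}.
  by apply: continuous_subspaceW cx; apply: subset_itvl.
(* Each mode has zero column sums, so the coordinate sum has zero derivative between switches, and
   continuity carries it across them. *)
have sum_cst T : 0 <= T -> \sum_i x T i 0 = \sum_i x0 i 0.
  move=> T0; rewrite -xx0; have [D DP] := sw T; apply/esym.
  apply: (@eq_finite_exceptions _ (fun s => \sum_i x s i 0) D 0 T T0).
    apply: (@continuous_coord_sum _ _ _ x (fun _ r => r)).
      by move=> i r; exact: cvg_id.
    exact: cxT.
  move=> t /andP[t0 tT] tD.
  have lt : locally_const_at sigma t by apply: DP; rewrite ?tD// !ltW.
  apply: (is_derive_eq (is_derive_sumf (dx t t0 lt))).
  transitivity (((const_mx 1 : 'rV[R]_n) *m M (sigma t) *m x t) 0 0).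
    rewrite -mulmxA mxE; apply: eq_bigr => i _.
    by rewrite [X in _ = X * _]mxE mul1r.
  by rewrite M1' mul0mx mxE.
pose a := (\sum_i x0 i 0) / n%:R.
exists a; pose y t := x t - const_mx a.
have y_sum t : 0 <= t -> \sum_i y t i 0 = 0.
  move=> t0; under eq_bigr do rewrite !mxE.
  rewrite sumrB sum_cst// sumr_const card_ord -mulr_natr /a.
  (* In dimension 0 the divisor [n%:R] is zero, but all sums are empty. *)
  have [n0|n0] := posnP n; last by rewrite divfK ?subrr// pnatr_eq0 -lt0n.
  rewrite big1 ?mul0r ?subr0// => i.
  by have := leq_ltn_trans (leq0n i) (ltn_ord i); rewrite lt0n => /eqP.
have decay T : 0 <= T -> dotv (y T) (y T) <= dotv (y 0) (y 0) * expR (- c * T).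
  move=> T0; rewrite -lerN2 -mulNr; have [D DP] := sw T.
  (* The growth lemma bounds from below, so it is applied to the negated squared norm with rate
     [- c]. *)
  apply: (@gronwall_ge _ (fun s => - dotv (y s) (y s)) D (- c) T T0).
    have -> : (fun s => - dotv (y s) (y s)) =
        fun s => \sum_i - (x s i 0 - a) ^+ 2.
      apply/funext => s; rewrite dotvE -sumrN.
      by apply: eq_bigr => i _; rewrite !mxE expr2.
    apply: (@continuous_coord_sum _ _ _ x (fun _ r => - (r - a) ^+ 2));
      last exact: cxT.
    move=> i r.
    apply: cvgN; rewrite expr2.
    by apply: cvgM; apply: cvgB; (exact: cvg_id || exact: cvg_cst).
  move=> t /andP[t0 tT] tD.
  have lt : locally_const_at sigma t by apply: DP; rewrite ?tD// !ltW.
  (* Every mode kills constant vectors, so the deviation [y] obeys the same equation as [x]. *)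
  have dy i : is_derive t (1 : R) (fun s => y s i 0) ((M (sigma t) *m y t) i 0).
    have -> : (fun s => y s i 0) = fun s => x s i 0 - a.
      by apply/funext => s; rewrite !mxE.
    apply: (is_derive_eq (is_deriveB (dx t t0 lt i) (is_derive_cst a t 1))).
    by rewrite subr0 /y mulmxBr signed_laplacian_const subr0.
  exists (- (2 * dotv (y t) (M (sigma t) *m y t))).
    by rewrite mulrN lerN2 cP// y_sum// ltW.
  apply: (is_derive_eq (is_deriveN (is_derive_dotv dy dy))).
  by rewrite dotvC mulr_natl.
apply/cvg_ballP => e e0; near=> t.
have t0 : 0 < t by near: t; exact: nbhs_pinfty_gt.
split=> // i j; rewrite (ord1 j) !mxE /ball /= distrC.
rewrite -(@ltr_pXn2r _ 2)// ?nnegrE ?(ltW e0)// real_normK ?num_real//.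
have -> : x t i 0 - a = y t i 0 by rewrite !mxE.
apply: le_lt_trans (sqr_le_dotvv _ _) _; apply: le_lt_trans (decay t (ltW t0)) _.
rewrite mulNr expRN ltr_pdivrMr ?expR_gt0//.
(* This threshold comes from [c * t <= expR (c * t)]: beyond it the decaying bound is below
   [e ^+ 2]. *)
have : dotv (y 0) (y 0) / (e ^+ 2 * c) < t.
  by near: t; apply: nbhs_pinfty_gt; exact: num_real.
rewrite ltr_pdivrMr ?mulr_gt0 ?exprn_gt0// => /lt_le_trans; apply.
rewrite mulrCA ler_wpM2l ?sqr_ge0// mulrC.
by apply: le_trans (expR_ge1Dx _); rewrite lerDr.
Unshelve. all: by end_near. Qed.
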